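(* Let $F$ be a storage fee function, let $\epsilon\in(0,\frac1{3N})$, and let $\psi_{in}$ be the input and $\psi_{out}$ the output of the parameter shuffling routine (described in the context) with tolerance $\epsilon$. Suppose that $F^*$ is differentiable, that $(\nabla F^* )^k\ge3\epsilon$ for all $k\in\{1,\dots,N\}$, and that for all $k\in\{1,\dots,N\}$ $$\frac{\partial F^*}{\partial\psi^k}(\psi_1)-\frac{\partial F^*}{\partial\psi^k}(\psi_2)\ \ge\ \sum_{j\ne k}\left|\frac{\partial F^*}{\partial\psi^j}(\psi_1)-\frac{\partial F^*}{\partial\psi^j}(\psi_2)\right|$$ whenever $\psi_1\in\mathbb{R}^N$ and $\psi_2=\psi_1-\gamma e^k$ with $\gamma\ge0$. Then $$\|\nabla\Phi(\psi_{out})\|_1\le\|\nabla\Phi(\psi_{in})\|_1 .$$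
   Context: Setting. $N\ge1$, $n\ge2$ are integers, $X\subset\mathbb{R}^n$ is compact, $Y=\{y_1,\dots,y_N\}\subset\mathbb{R}^n$ consists of $N$ distinct points, $c:X\times Y\to\mathbb{R}$. $\mu$ is a Borel probability measure supported in $X$, absolutely continuous with respect to Lebesgue measure, with density $\rho$ that is $\alpha$-Hölder continuous, $\alpha\in(0,1]$. The cost satisfies: (Reg) $c(\cdot,y_i)\in C^2(X)$ for all $i$; (Twist) $\nabla_x c(x,y_i)\ne\nabla_x c(x,y_k)$ for all $x\in X$, $i\ne k$; (QC) for each $i$ there are a convex set $Y_i\subset\mathbb{R}^n$ and a $C^2$ diffeomorphism $\exp_i:Y_i\to X$ such that for all $t\in\mathbb{R}$ and $1\le k,i\le N$ the set $\{p\in Y_i: -c(\exp_i(p),y_k)+c(\exp_i(p),y_i)\le t\}$ is convex. $X$ is $c$-convex with respect to $Y$: $\exp_i^{-1}(X)$ is convex for every $i$. $\Lambda=\{\lambda\in\mathbb{R}^N:\sum_i\lambda^i=1,\ \lambda^i\ge0\}$; $\|\cdot\|_1$ is the $\ell^1$ norm; $e^k$ is the $k$-th standard basis vector; components are superscripts. A storage fee function is a proper closed convex function $F:\mathbb{R}^N\to\mathbb{R}\cup\{+\infty\}$ with effective domain contained in $\Lambda$; $F^*(\psi)=\sup_\lambda(\langle\psi,\lambda\rangle-F(\lambda))$ is its convex conjugate. For $\psi\in\mathbb{R}^N$, $\operatorname{Lag}_i(\psi)=\{x\in X: c(x,y_i)+\psi^i=\min_j (c(x,y_j)+\psi^j)\}$,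 $G^i(\psi)=\mu(\operatorname{Lag}_i(\psi))$, $G=(G^1,\dots,G^N)$. $\Phi(\psi)=\int_X\min_i(c(x,y_i)+\psi^i)\,d\mu-F^*(\psi)$, so $\nabla\Phi=G-\nabla F^*$. Parameter shuffling routine. Input: tolerance $\epsilon\in(0,\frac1{3N})$ and $\psi_{in}\in\mathbb{R}^N$. Set $\psi:=\psi_{in}$. While $\min_jG^j(\psi)\le\epsilon$: for $i=1,\dots,N$ in order, if $G^i(\psi)\le\epsilon$ then find $r>0$ with $G^i(\psi-re^i)\in[2\epsilon,3\epsilon]$ and set $\psi:=\psi-re^i$. Return $\psi_{out}:=\psi$. *)

(* Defs.v *)
From HB Require Import structures.
From mathcomp Require Import all_boot all_order all_algebra.
From mathcomp Require Import all_classical all_reals all_analysis.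
From mathcomp Require Import measurable_realfun ring lra.

Set Implicit Arguments.
Unset Strict Implicit.
Unset Printing Implicit Defensive.

Import Order.TTheory GRing.Theory Num.Theory.
Import numFieldNormedType.Exports.

Local Open Scope classical_set_scope.
Local Open Scope ring_scope.

Definition borel_rV (R : realType) (n : nat) :=
  g_sigma_algebraType (@open 'rV[R]_n).

Section lebesgue_rV.
Context {R : realType}.

Lemma measurable_coord_rV n (i : 'I_n) :
  measurable_fun setT (fun v : borel_rV R n => (v : 'rV[R]_n) ord0 i).
Proof.
apply: (measurability _ (measurable_realfun.RGenOpens.measurableE R)) => //.
move=> _ [_ [a [b ->]] <-]; rewrite setTI.
apply: sub_sigma_algebra.
apply: (@open_comp _ _ (fun v : 'rV[R]_n => v ord0 i)).
  by move=> v _; exact: coord_continuous.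
exact: interval_open.
Qed.

Definition rat_ball n (qr : 'rV[rat]_n * rat) : set 'rV[R]_n :=
  ball (map_mx ratr qr.1 : 'rV[R]_n) (ratr qr.2).

Lemma open_rat_ballE n (O : set 'rV[R]_n) : open O ->
  O = \bigcup_(qr in [set qr | rat_ball qr `<=` O]) rat_ball qr.
Proof.
move=> oO; apply/seteqP; split => [v Ov|v [qr /= sO]]; last exact: sO.
have /nbhs_ballP[_/posnumP[e] veO] : nbhs v O by exact: open_nbhs_nbhs.
have [r r0 re] : exists2 r : rat, 0 < ratr r :> R & ratr r < e%:num / 2.
  have /rat_in_itvoo[r] : 0 < e%:num / 2 :> R by [].
  by rewrite in_itv /= => /andP[? ?]; exists r.
have /choice[q qv] : forall i : 'I_n, exists q : rat,
    v ord0 i - ratr r < ratr q < v ord0 i + ratr r.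
  move=> i; have /rat_in_itvoo[q] : v ord0 i - ratr r < v ord0 i + ratr r.
    by rewrite ltrBlDr -addrA ltrDl addr_gt0.
  by rewrite in_itv /=; exists q.
have bq w : rat_ball (\row_i q i, r) w <->
    forall i, `|ratr (q i) - w ord0 i| < ratr r :> R.
  split=> [[_ h] i|h]; first by have := h ord0 i; rewrite !mxE.
  by split => // i j; rewrite (ord1 i) !mxE; exact: h.
exists (\row_i q i, r) => /=; last first.
  by apply/bq => i; rewrite distrC ltr_distlC; case/andP: (qv i) => ? ?; apply/andP; split; lra.
move=> w /bq wq; apply: veO; split => // i j; rewrite (ord1 i) /ball /=.
have := wq j; have := qv j.
rewrite !ltr_distl; move=> /andP[? ?] /andP[? ?]; apply/andP; split; lra.
Qed.

Lemma measurable_fun_rV d (T : measurableType d) n (f : T -> borel_rV R n) :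
  (forall i, measurable_fun setT (fun t => (f t : 'rV[R]_n) ord0 i)) ->
  measurable_fun setT f.
Proof.
move=> mf; apply: (@measurability _ _ T (borel_rV R n) _ _ (@open 'rV[R]_n)) => //.
move=> _ [U oU <-]; rewrite setTI (open_rat_ballE oU) preimage_bigcup.
rewrite bigcup_mkcond; apply: countable_bigcupT_measurable => // -[q r].
case: ifP => // _; have [r0|r0] := ltP (0 : R) (ratr r); last first.
  rewrite (_ : _ @^-1` _ = set0) //; apply/seteqP; split => // t [] /=.
  by rewrite ltNge r0.
rewrite (_ : _ @^-1` _ = \bigcap_i
  ((fun t => (f t : 'rV[R]_n) ord0 i) @^-1` (ball (ratr (q ord0 i) : R) (ratr r)))).
  rewrite -[X in measurable X]setCK setC_bigcap; apply: measurableC.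
  apply: fin_bigcup_measurable => // i _; apply: measurableC.
  by rewrite -[X in measurable X]setTI; apply: mf => //; exact: measurable_ball.
apply/seteqP; split => t /=.
  by move=> [_ h] i _; have := h ord0 i; rewrite mxE.
by move=> h; split => // i j; rewrite (ord1 i) mxE; exact: h.
Qed.

Definition cons_rV n (p : measurableTypeR R * borel_rV R n) :
    borel_rV R n.+1 :=
  \row_i (if unlift ord0 i is Some j then (p.2 : 'rV[R]_n) ord0 j else p.1).

Definition uncons_rV n (v : borel_rV R n.+1) :
    measurableTypeR R * borel_rV R n :=
  ((v : 'rV[R]_n.+1) ord0 ord0,
   \row_i (v : 'rV[R]_n.+1) ord0 (lift ord0 i)).

Lemma cons_rVK n : cancel (@cons_rV n) (@uncons_rV n).
Proof.
move=> [a v]; rewrite /uncons_rV /cons_rV /= mxE unlift_none; congr pair.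
by apply/rowP => i; rewrite !mxE liftK.
Qed.

Lemma uncons_rVK n : cancel (@uncons_rV n) (@cons_rV n).
Proof.
move=> v; apply/rowP => i; rewrite mxE /uncons_rV /=.
by case: unliftP => [j ->|->] //; rewrite mxE.
Qed.

Lemma measurable_cons_rV n : measurable_fun setT (@cons_rV n).
Proof.
apply: measurable_fun_rV => i; rewrite /cons_rV.
case: (unliftP ord0 i) => [j ->|->].
  rewrite (_ : (fun t => _) = (fun v : borel_rV R n => (v : 'rV[R]_n) ord0 j) \o snd).
    by apply: measurableT_comp; [exact: measurable_coord_rV|exact: measurable_snd].
  by apply/funext => t /=; rewrite mxE liftK.
rewrite (_ : (fun t => _) = fst) //; last first.
  by apply/funext => t /=; rewrite mxE unlift_none.
Qed.

Lemma measurable_uncons_rV n : measurable_fun setT (@uncons_rV n).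
Proof.
apply: measurable_fun_pair; first exact: measurable_coord_rV.
apply: measurable_fun_rV => i; rewrite (_ : (fun t => _) =
  (fun v : borel_rV R n.+1 => (v : 'rV[R]_n.+1) ord0 (lift ord0 i))).
  exact: measurable_coord_rV.
by apply/funext => t; rewrite mxE.
Qed.

Section step.
Context (n : nat) (m : {sigma_finite_measure set (borel_rV R n) -> \bar R}).

(* Product of the Lebesgue measures on R and on R^n, transported along the
   bijection R * R^n -> R^(n+1). *)
Definition lebesgue_rV_step : set (borel_rV R n.+1) -> \bar R :=
  pushforward (@lebesgue_measure R \x m)%E (@cons_rV n).

Let pf : {measure set (borel_rV R n.+1) -> \bar R} :=
  measure_function_pushforward__canonical__measure_function_Measure
    (product_measure1 (@lebesgue_measure R) m) (@measurable_cons_rV n).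

HB.instance Definition _ := isMeasure.Build _ _ _ lebesgue_rV_step
  (measure0 pf) (measure_ge0 pf) (@measure_semi_sigma_additive _ _ _ pf).

Let lebesgue_rV_step_sigma_finite : sigma_finite setT lebesgue_rV_step.
Proof.
have /sigma_finiteP[F [FT ndF Foo]] := sigma_finiteT (@lebesgue_measure R).
have /sigma_finiteP[G [GT ndG Goo]] := sigma_finiteT m.
have cK A : @cons_rV n @^-1` (@uncons_rV n @^-1` A) = A.
  by apply/funext => t; rewrite /preimage /= cons_rVK.
exists (fun k => @uncons_rV n @^-1` (F k `*` G k)).
  apply/seteqP; split => // v _.
  have [k _ Fk] : (\bigcup_k F k) (uncons_rV v).1 by rewrite -FT.
  have [l _ Gl] : (\bigcup_k G k) (uncons_rV v).2 by rewrite -GT.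
  exists (maxn k l) => //; split.
    by move: Fk; exact/subsetPset/ndF/leq_maxl.
  by move: Gl; exact/subsetPset/ndG/leq_maxr.
move=> k; have [mF Fk] := Foo k; have [mG Gk] := Goo k; split.
  rewrite -[X in measurable X]setTI; apply: measurable_uncons_rV => //.
  exact: measurableX.
rewrite /lebesgue_rV_step /pushforward cK product_measure1E//.
by rewrite lte_mul_pinfty// ge0_fin_numE.
Qed.

HB.instance Definition _ := Measure_isSigmaFinite.Build _ _ _ lebesgue_rV_step
  lebesgue_rV_step_sigma_finite.

End step.

Fixpoint lebesgue_rV n : {sigma_finite_measure set (borel_rV R n) -> \bar R} :=
  match n with
  | 0 => @dirac _ (borel_rV R 0) (0 : 'rV[R]_0) R
  | n.+1 => lebesgue_rV_step (lebesgue_rV n)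
  end.

Lemma lebesgue_rV_box n (a b : 'rV[R]_n) : (forall i, a ord0 i <= b ord0 i) ->
  lebesgue_rV n [set v : 'rV[R]_n | forall i, v ord0 i \in `]a ord0 i, b ord0 i]]
  = (\prod_i (b ord0 i - a ord0 i))%:E.
Proof.
elim: n => [|n IH] in a b * => ab.
  rewrite big_ord0 /= /dirac indicE mem_set //=; last by case.
rewrite big_ord_recl /= /lebesgue_rV_step /pushforward.
pose a' := \row_i a ord0 (lift ord0 i); pose b' := \row_i b ord0 (lift ord0 i).
have mbox k (c d : 'rV[R]_k) : measurable ([set v : 'rV[R]_k | forall i,
    v ord0 i \in `]c ord0 i, d ord0 i]] : set (borel_rV R k)).
  rewrite (_ : mkset _ = \bigcap_i ((fun v : borel_rV R k => (v : 'rV[R]_k) ord0 i)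
      @^-1` `]c ord0 i, d ord0 i])).
    apply: fin_bigcap_measurable => // i _.
    by rewrite -[X in measurable X]setTI; apply: (measurable_coord_rV i) => //; exact: measurable_itv.
  by apply/seteqP; split => v /= h i; [move=> _; exact: h|exact: (h i I)].
rewrite (_ : _ @^-1` _ = `]a ord0 ord0, b ord0 ord0] `*`
    [set v : 'rV[R]_n | forall i, v ord0 i \in `]a' ord0 i, b' ord0 i]]).
  rewrite product_measure1E; [|exact: measurable_itv|exact: mbox].
  rewrite IH; last by move=> i; rewrite !mxE.
  under eq_bigr do rewrite !mxE.
  rewrite EFinM; congr (_ * _)%E.
  transitivity (lebesgue_measure (`]a ord0 ord0, b ord0 ord0] : set R)) => //.
  rewrite lebesgue_measure_itv /= lte_fin.
  have [//|ba] := ltP.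
  by have -> : a ord0 ord0 = b ord0 ord0 by [apply/le_anti; rewrite ab ba]; rewrite subrr.
apply/seteqP; split => -[t v] /=.
  move=> h; split => [|i].
    by have := h ord0; rewrite /cons_rV mxE unlift_none.
  by have := h (lift ord0 i); rewrite /cons_rV !mxE liftK.
move=> [h0 h] i; rewrite /cons_rV mxE; case: unliftP => [j ->|->] //=.
by have := h j; rewrite !mxE.
Qed.

End lebesgue_rV.

Section calculus.
Context {R : realType}.
Implicit Type n : nat.

Definition partial n (f : 'rV[R]_n -> R) (k : 'I_n) (x : 'rV[R]_n) : R :=
  'D_(delta_mx ord0 k) f x.

Definition grad n (f : 'rV[R]_n -> R) (x : 'rV[R]_n) : 'rV[R]_n :=
  \row_k partial f k x.

Definition C2_open n (U : set 'rV[R]_n) (f : 'rV[R]_n -> R) :=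
  forall x, U x -> differentiable f x /\
    forall i, differentiable (partial f i) x /\
      forall j, {for x, continuous (partial (partial f i) j)}.

(* On a set that need not be open, C^2 means C^2 on some open neighbourhood,
   so that derivatives at boundary points make sense. *)
Definition C2_on n (A : set 'rV[R]_n) (f : 'rV[R]_n -> R) :=
  exists U : set 'rV[R]_n, [/\ open U, A `<=` U & C2_open U f].

Definition C2_diffeo n (A B : set 'rV[R]_n) (f : 'rV[R]_n -> 'rV[R]_n) :=
  exists g : 'rV[R]_n -> 'rV[R]_n,
    [/\ (forall p, A p -> B (f p) /\ g (f p) = p),
        (forall x, B x -> A (g x) /\ f (g x) = x),
        (forall k, C2_on A (fun p => f p ord0 k)) &
        (forall k, C2_on B (fun x => g x ord0 k))].

Definition norm1 n (v : 'rV[R]_n) : R := \sum_i `|v ord0 i|.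

Definition dotp n (u v : 'rV[R]_n) : R := \sum_i u ord0 i * v ord0 i.

(* Minimum of finitely many reals; the neutral element +oo is only returned
   for the empty family. *)
Definition minI n (f : 'I_n -> R) : \bar R :=
  \big[Order.min/+oo%E]_(i < n) (f i)%:E.

(* The norm on 'rV[R]_n is the sup norm, which is equivalent to the Euclidean
   one. *)
Definition holder_on n (alpha : R) (A : set 'rV[R]_n) (f : 'rV[R]_n -> R) :=
  exists2 C : R, 0 <= C &
    forall x y, A x -> A y -> `|f x - f y| <= C * `|x - y| `^ alpha.

End calculus.

Section semidiscrete_transport.
Context {R : realType} {n N : nat}.
Variables (X : set 'rV[R]_n) (y : 'I_N -> 'rV[R]_n).
Variable c : 'rV[R]_n -> 'rV[R]_n -> R.

Definition Reg := forall i, C2_on X (fun x => c x (y i)).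

Definition Twist := forall x i k, X x -> i != k ->
  grad (fun x => c x (y i)) x <> grad (fun x => c x (y k)) x.

Definition QC (Yexp : 'I_N -> set 'rV[R]_n)
    (expc : 'I_N -> 'rV[R]_n -> 'rV[R]_n) :=
  forall i, [/\ convex_set (Yexp i), C2_diffeo (Yexp i) X (expc i) &
    forall (t : R) (k : 'I_N),
      convex_set [set p | Yexp i p /\
        - c (expc i p) (y k) + c (expc i p) (y i) <= t]].

Definition c_convex (Yexp : 'I_N -> set 'rV[R]_n)
    (expc : 'I_N -> 'rV[R]_n -> 'rV[R]_n) :=
  forall i, convex_set (Yexp i `&` expc i @^-1` X).

Definition Lag (psi : 'rV[R]_N) (i : 'I_N) : set 'rV[R]_n :=
  [set x | X x /\
    (c x (y i) + psi ord0 i)%:E = minI (fun j => c x (y j) + psi ord0 j)].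

Variable mu : probability (borel_rV R n) R.

Definition G (psi : 'rV[R]_N) : 'rV[R]_N := \row_i fine (mu (Lag psi i)).

Definition simplex : set 'rV[R]_N :=
  [set l | \sum_i l ord0 i = 1 /\ forall i, 0 <= l ord0 i].

(* For a convex function that never takes the value -oo, being closed is the
   same as being lower semicontinuous. *)
Definition storage_fee (F : 'rV[R]_N -> \bar R) :=
  [/\ (forall l, (-oo < F l)%E) /\ (exists l, (F l < +oo)%E),
      lower_semicontinuous F,
      (forall (l1 l2 : 'rV[R]_N) (t : R), 0 <= t <= 1 ->
        (F (t *: l1 + (1 - t) *: l2)%R <= t%:E * F l1 + (1 - t)%R%:E * F l2)%E) &
      forall l, (F l < +oo)%E -> simplex l].

Definition conjugate (F : 'rV[R]_N -> \bar R) (psi : 'rV[R]_N) : \bar R :=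
  ereal_sup [set ((dotp psi l)%:E - F l)%E | l in [set: 'rV[R]_N]].

(* The conjugate of a storage fee function is finite everywhere, since
   F is proper, closed, and has a bounded effective domain. *)
Definition Fstar (F : 'rV[R]_N -> \bar R) (psi : 'rV[R]_N) : R :=
  fine (conjugate F psi).

Definition Phi (F : 'rV[R]_N -> \bar R) (psi : 'rV[R]_N) : R :=
  fine (\int[mu]_(x in X) minI (fun i => c x (y i) + psi ord0 i)%R)%E
  - Fstar F psi.

(* One iteration of the inner loop. The routine is a relation between input
   and output: the choice of r is not determined, and termination is not
   assumed. *)
Definition shuffle_step (eps : R) (i : 'I_N) (psi psi' : 'rV[R]_N) :=
  if G psi ord0 i <= eps then
    exists r : R, [/\ 0 < r, psi' = psi - r *: delta_mx ord0 i &
      2 * eps <= G psi' ord0 i <= 3 * eps]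
  else psi' = psi.

Inductive shuffle_for (eps : R) : seq 'I_N -> 'rV[R]_N -> 'rV[R]_N -> Prop :=
| shuffle_for_nil psi : shuffle_for eps [::] psi psi
| shuffle_for_cons i s psi psi' psi'' :
    shuffle_step eps i psi psi' -> shuffle_for eps s psi' psi'' ->
    shuffle_for eps (i :: s) psi psi''.

Inductive shuffle (eps : R) : 'rV[R]_N -> 'rV[R]_N -> Prop :=
| shuffle_return psi :
    ~ (minI (G psi ord0) <= eps%:E)%E -> shuffle eps psi psi
| shuffle_while psi psi' psi'' :
    (minI (G psi ord0) <= eps%:E)%E ->
    shuffle_for eps (enum 'I_N) psi psi' -> shuffle eps psi' psi'' ->
    shuffle eps psi psi''.

End semidiscrete_transport.

(* Main.v *)
Require Import Defs.
From HB Require Import structures.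
From mathcomp Require Import all_boot all_order all_algebra.
From mathcomp Require Import all_classical all_reals all_analysis.
From mathcomp Require Import measurable_realfun ring lra.

Set Implicit Arguments.
Unset Strict Implicit.
Unset Printing Implicit Defensive.

Import Order.TTheory GRing.Theory Num.Theory.
Import numFieldNormedType.Exports.

Local Open Scope classical_set_scope.
Local Open Scope ring_scope.

(* By (Twist), the set where two costs differ by a given constant is locally a
   set meeting every line parallel to some coordinate axis at most once, hence
   Lebesgue-null by Fubini.  So the Laguerre cells overlap in null sets, G^k is
   continuous along e^k, and squeezing the difference quotients of the
   transport part of Phi between values of G^k yields grad Phi = G - grad F*.
   One step of the routine replaces psi by psi - r e^i.  It moves mass
   G^i(psi') - G^i(psi) from the other cells to cell i, which by [hFdom]
   increases the other components of |G - grad F*| by at most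
   (G^i(psi') - G^i(psi)) + (d_i F*(psi) - d_i F*(psi')).  Since
   G^i <= 3 eps <= d_i F* before and after the step, that is exactly what
   component i loses. *)

(** * Measurability and Lebesgue-null sets in R^n *)

Lemma open_measurable_rV (R : realType) n (U : set 'rV[R]_n) :
  open U -> measurable (U : set (borel_rV R n)).
Proof. by move=> oU; apply: sub_sigma_algebra. Qed.

Lemma closed_measurable_rV (R : realType) n (U : set 'rV[R]_n) :
  closed U -> measurable (U : set (borel_rV R n)).
Proof.
move=> cU; rewrite -[U]setCK; apply: measurableC.
by apply: open_measurable_rV; exact: closed_openC.
Qed.

(** Fubini, by induction on the dimension: if [k] is not the first coordinate, the slices at a fixed
    first coordinate inherit the hypothesis; if it is, the slices along it have at most one
    point. *)
Lemma lebesgue_rV_line_null (R : realType) n (k : 'I_n)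
    (A : set (borel_rV R n)) :
  measurable A ->
  (forall u v : 'rV[R]_n, A u -> A v ->
    (forall j, j != k -> u ord0 j = v ord0 j) -> u = v) ->
  lebesgue_rV n A = 0%E.
Proof.
elim: n => [|n IH] in k A *; first by case: k.
move=> mA A1; rewrite /= /lebesgue_rV_step /pushforward.
set B := _ @^-1` A.
have mB : measurable B.
  by rewrite -[B]setTI; exact: measurable_cons_rV.
case: (unliftP ord0 k) => [j kj|k0].
  rewrite /product_measure1; apply: integral0_eq => t _ /=.
  apply: (IH j); first exact: measurable_xsection.
  move=> u v; rewrite !xsectionE /B /= => Bu Bv uv.
  have : cons_rV (t, u) = cons_rV (t, v).
    apply: A1 => // i; rewrite kj !mxE; case: unliftP => //= l ->.
    by rewrite (inj_eq lift_inj); exact: uv.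
  by move=> /(congr1 (@uncons_rV _ _)); rewrite !cons_rVK => -[].
(* The first coordinate has to be integrated innermost here; uniqueness of the product measure
   allows the order to be exchanged. *)
have -> : (lebesgue_measure \x lebesgue_rV n)%E B
          = (lebesgue_measure \x^ lebesgue_rV n)%E B.
  by apply: product_measure_unique => // C D mC mD; exact: product_measure2E.
rewrite /product_measure2; apply: integral0_eq => w _ /=.
have sub1 s t : ysection B w s -> ysection B w t -> s = t.
  rewrite !ysectionE /B /= => Bs Bt.
  have : cons_rV (s, w) = cons_rV (t, w).
    apply: A1 => // i; rewrite k0 !mxE; case: unliftP => //= [->].
    by rewrite eqxx.
  by move=> /(congr1 (@uncons_rV _ _)); rewrite !cons_rVK => -[].
have [->|/set0P[s Bs]] := eqVneq (ysection B w) set0; first exact: measure0.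
rewrite (_ : ysection B w = [set s]) ?lebesgue_measure_set1//.
by apply/seteqP; split => [t Bt|t ->//]; exact: sub1.
Qed.

Lemma is_derive_line (R : realType) n (f : 'rV[R]_n -> R) (u e : 'rV[R]_n)
    (s : R) :
  differentiable f (u + s *: e) ->
  is_derive s 1 (fun t => f (u + t *: e)) ('D_e f (u + s *: e)).
Proof.
move=> df.
have /derivableP[dd _] : derivable f (u + s *: e) e by exact: diff_derivable.
have E : (fun h : R => h^-1 *:
      (((fun t => f (u + t *: e)) \o shift s) (h *: 1) - f (u + s *: e)))
  = (fun h => h^-1 *: ((f \o shift (u + s *: e)) (h *: e) - f (u + s *: e))).
  by apply/funext => h /=; rewrite scaler1 scalerDl addrCA addrA.
by split; rewrite /derivable /derive E.
Qed.

(** By Rolle, two points of one level set on a line parallel to the [k]-th axis would have a zero of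
    [partial f k] between them. *)
Lemma level_set_line_inj (R : realType) n (f : 'rV[R]_n -> R) (k : 'I_n)
    (x : 'rV[R]_n) (r t : R) :
  (forall z, ball x r z -> differentiable f z /\ partial f k z != 0) ->
  forall u v, ball x r u -> ball x r v -> f u = t -> f v = t ->
    (forall j, j != k -> u ord0 j = v ord0 j) -> u = v.
Proof.
move=> H.
have main u v : ball x r u -> ball x r v -> f u = t -> f v = t ->
    (forall j, j != k -> u ord0 j = v ord0 j) -> ~ u ord0 k < v ord0 k.
  move=> bu bv fu fv uv ltuv.
  pose g s := f (u + s *: delta_mx ord0 k).
  pose d := v ord0 k - u ord0 k.
  have d0 : 0 < d by rewrite subr_gt0.
  (* Balls are those of the sup norm, so membership is checked coordinatewise; only coordinate [k]
     moves, and it stays between those of [u] and [v]. *)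
  have bl s : 0 <= s <= d -> ball x r (u + s *: delta_mx ord0 k).
    move=> /andP[s0 sd]; case: (bu) => r0 bu'; split=> // i j.
    have := bu' i j; have := bv.2 i j; rewrite !(ord1 i) /ball /= !mxE eqxx /=.
    have [->|jk] := eqVneq j k.
      rewrite mulr1 !ltr_norml => /andP[? ?] /andP[? ?]; rewrite /d in sd.
      by apply/andP; split; lra.
    by rewrite mulr0 addr0.
  have dg s : 0 <= s <= d ->
      is_derive s 1 g (partial f k (u + s *: delta_mx ord0 k)).
    by move=> /bl /H [df _]; exact: is_derive_line.
  have vE : u + d *: delta_mx ord0 k = v.
    apply/rowP => j; rewrite !mxE eqxx /=.
    have [->|jk] := eqVneq j k; first by rewrite mulr1 /d addrC subrK.
    by rewrite mulr0 addr0 uv.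
  have : exists2 s, s \in `]0, d[ & is_derive s (1 : R) g 0.
    apply: Rolle => //.
    - move=> s; rewrite in_itv /= => /andP[s0 sd].
      have [] // := dg s _; by rewrite !ltW.
    - apply: derivable_within_continuous => s; rewrite in_itv /= => sd.
      by have [] := dg _ sd.
    - by rewrite /g scale0r addr0 vE fu fv.
  move=> [s]; rewrite in_itv /= => /andP[s0 sd] ds.
  have sd' : 0 <= s <= d by rewrite !ltW.
  have [_ /eqP] := H _ (bl _ sd'); apply.
  have [_ <-] := dg _ sd'; by have [_ ->] := ds.
move=> u v bu bv fu fv uv.
have nlt := main _ _ bu bv fu fv uv.
have nlt' : ~ v ord0 k < u ord0 k by apply: (main v u) => // j jk; rewrite uv.
apply/rowP => j; have [->|/uv//] := eqVneq j k.
by have [] := ltgtP (u ord0 k) (v ord0 k).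
Qed.

Lemma negligible_countable_bigcup d (T : measurableType d) (R : realType)
    (mu : {measure set T -> \bar R}) (I : countType) (B : set I)
    (F : I -> set T) :
  (forall i, B i -> mu.-negligible (F i)) ->
  mu.-negligible (\bigcup_(i in B) F i).
Proof.
move=> nF.
(* The union is re-indexed by natural numbers; a number that encodes no element of [B] contributes
   the empty set. *)
pose G m := if unpickle m is Some i then if `[< B i >] then F i else set0
            else set0 : set T.
apply: (@negligibleS _ _ _ mu (\bigcup_m G m)).
  by move=> x [i Bi Fx]; exists (pickle i) => //; rewrite /G pickleK asboolT.
apply: negligible_bigcup => m; rewrite /G.
case: unpickle => [i|]; last exact: negligible_set0.
by case: asboolP => [/nF//|_]; exact: negligible_set0.
Qed.

(** Continuity is only available at points of [X], so closedness is checked at a limit point, which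
    lies in [X] because [X] is closed. *)
Lemma coincidence_closed (R : realType) n (f g : 'rV[R]_n -> R)
    (X : set 'rV[R]_n) (t : R) :
  closed X ->
  (forall x, X x -> {for x, continuous f} /\ {for x, continuous g}) ->
  closed [set x | X x /\ f x - g x = t].
Proof.
move=> cX cfg x clx.
have Xx : X x by apply: cX; apply: closureS clx => z [].
split=> //; apply/eqP/negPn/negP => fgt.
have [cf cg] := cfg _ Xx.
have ch : {for x, continuous (fun z => f z - g z)}.
  exact: (@cvgB R R^o _ (nbhs x) _ f g _ _ cf cg).
have /clx : nbhs x [set z | f z - g z != t].
  apply: (ch [set s | s != t]); apply: open_nbhs_nbhs.
  by split => //; exact: open_neq.
by move=> [z [[_ fz] /eqP]]; exact.
Qed.

(** Near each point of the set some partial derivative of [f - g] does not vanish. Countably many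
    rational balls with this property cover the set, and in each of them [level_set_line_inj] and
    [lebesgue_rV_line_null] apply. *)
Lemma coincidence_null (R : realType) n (f g : 'rV[R]_n -> R)
    (X U : set 'rV[R]_n) (t : R) :
  closed X -> open U -> X `<=` U -> C2_open U f -> C2_open U g ->
  (forall x, X x -> grad f x <> grad g x) ->
  lebesgue_rV n [set x | X x /\ f x - g x = t] = 0%E.
Proof.
move=> cX oU XU Cf Cg fg.
pose Z := [set x | X x /\ f x - g x = t].
have cont x : X x -> {for x, continuous f} /\ {for x, continuous g}.
  by move=> /XU Ux; split; apply: differentiable_continuous;
    [have [] := Cf _ Ux|have [] := Cg _ Ux].
have cZ : closed Z by exact: coincidence_closed.
have mZ : measurable (Z : set (borel_rV R n)) by exact: closed_measurable_rV.
pose h z := f z - g z.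
have dh z : U z -> differentiable h z.
  move=> Uz; apply: differentiableB; first by have [] := Cf _ Uz.
  by have [] := Cg _ Uz.
have ph k z : U z -> partial h k z = partial f k z - partial g k z.
  move=> Uz; rewrite /partial; apply: deriveB; apply: diff_derivable.
    by have [] := Cf _ Uz.
  by have [] := Cg _ Uz.
(* An index records a rational ball together with the coordinate whose partial derivative is nonzero
   on it; such indices are countable. *)
pose P (b : ('rV[rat]_n * rat) * 'I_n) := forall z, @rat_ball R n b.1 z ->
  differentiable h z /\ partial h b.2 z != 0.
have cover : Z `<=` \bigcup_(b in P) (Z `&` @rat_ball R n b.1).
  move=> x Zx; have Ux : U x by apply: XU; case: Zx.
  have [k pk] : exists k, partial f k x - partial g k x != 0.
    apply/not_existsP => H; apply: (fg x); first by case: Zx.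
    apply/rowP => k; rewrite !mxE; apply/eqP; rewrite -subr_eq0.
    by apply/negPn/negP; exact: H.
  have cp : {for x, continuous (fun z => partial f k z - partial g k z)}.
    have [_ /(_ k)[/differentiable_continuous cf _]] := Cf _ Ux.
    have [_ /(_ k)[/differentiable_continuous cg _]] := Cg _ Ux.
    exact: (@cvgB R R^o _ (nbhs x) _ _ _ _ _ cf cg).
  have : nbhs x (U `&` [set z | partial f k z - partial g k z != 0]).
    apply: filterI; first exact: open_nbhs_nbhs.
    apply: (cp [set s | s != 0]); apply: open_nbhs_nbhs.
    by split => //; exact: open_neq.
  rewrite nbhsE => -[V [oV Vx] VU].
  move: Vx; rewrite (open_rat_ballE oV) => -[q /= qV qx].
  exists (q, k) => //= z /qV /VU [Uz pz]; split; first exact: dh.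
  by rewrite ph.
have : (lebesgue_rV n).-negligible (Z : set (borel_rV R n)).
  apply: (@negligibleS _ (borel_rV R n) _ (lebesgue_rV n) _ _ cover).
  apply: negligible_countable_bigcup => -[[q r] k] Pb.
  have mA : measurable (Z `&` @rat_ball R n (q, r) : set (borel_rV R n)).
    by apply: measurableI => //; apply: open_measurable_rV; exact: ball_open.
  apply/negligibleP => //; apply: (lebesgue_rV_line_null (k := k)) => //.
  move=> u v [[_ fu] bu] [[_ fv] bv].
  exact: (level_set_line_inj Pb bu bv fu fv).
by move=> /negligibleP; apply.
Qed.

(** * Laguerre cells and the pointwise minimum *)

Section cells.
Context {R : realType} {n N : nat}.
Context (X : set 'rV[R]_n) (y : 'I_N -> 'rV[R]_n).
Context (c : 'rV[R]_n -> 'rV[R]_n -> R).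
Implicit Types (psi : 'rV[R]_N) (i j k : 'I_N) (x : 'rV[R]_n).

(** The index [k] witnesses that the family is nonempty, which excludes the default value [+oo]. It
    serves the same purpose in several lemmas below. *)
Lemma minIE (f : 'I_N -> R) k :
  exists2 i, minI f = (f i)%:E & forall j, f i <= f j.
Proof.
rewrite /minI (@bigmin_eq_arg _ _ _ _ k) //; last by move=> *; exact: leey.
case: arg_minP => // i _ H; exists i => // j.
by have := H j isT; rewrite lee_fin.
Qed.

Lemma LagP psi i x : Lag X y c psi i x <->
  X x /\ forall j, c x (y i) + psi ord0 i <= c x (y j) + psi ord0 j.
Proof.
pose f j := c x (y j) + psi ord0 j.
have [l minl lmin] := minIE f i.
rewrite /Lag /= -/f (_ : minI _ = (f l)%:E) //; split=> -[Xx].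
  by move=> [fi]; split => // j; rewrite -/(f i) -/(f j) /f fi; exact: lmin.
move=> H; split => //; congr EFin; apply/le_anti/andP; split; first exact: H.
exact: lmin.
Qed.

Lemma Lag_cover psi x k : X x -> exists i, Lag X y c psi i x.
Proof.
move=> Xx; have [i _ H] := minIE (fun i => c x (y i) + psi ord0 i) k.
by exists i; apply/LagP.
Qed.

(** Lowering the [i]-th entry makes only the competitor [i] stronger, so a point still in cell [j]
    was there before. *)
Lemma Lag_lower psi i (h : R) j : 0 <= h -> j != i ->
  Lag X y c (psi - h *: delta_mx ord0 i) j `<=` Lag X y c psi j.
Proof.
move=> h0 ji x /LagP[Xx H]; apply/LagP; split => // l.
have := H l; rewrite !mxE !eqxx /= (negbTE ji) /= mulr0 subr0.
move=> /le_trans; apply.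
by rewrite lerD2l gerBl mulr_ge0.
Qed.

Lemma Lag_line_antimono psi k (s t : R) : s <= t ->
  Lag X y c (t *: delta_mx ord0 k + psi) k `<=`
  Lag X y c (s *: delta_mx ord0 k + psi) k.
Proof.
move=> st x /LagP[Xx H]; apply/LagP; split => // j.
have := H j; rewrite !mxE !eqxx /= !mulr1.
have [->|jk] := eqVneq j k; first by rewrite !mulr1.
by rewrite !mulr0 !add0r => ?; lra.
Qed.

Lemma Lag_line_le0 psi k (s : R) : s <= 0 ->
  Lag X y c psi k `<=` Lag X y c (s *: delta_mx ord0 k + psi) k.
Proof. by move=> /(@Lag_line_antimono psi k); rewrite scale0r add0r. Qed.

Lemma Lag_line_ge0 psi k (s : R) : 0 <= s ->
  Lag X y c (s *: delta_mx ord0 k + psi) k `<=` Lag X y c psi k.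
Proof. by move=> /(@Lag_line_antimono psi k); rewrite scale0r add0r. Qed.

Definition fee_min psi x : R := fine (minI (fun i => c x (y i) + psi ord0 i)).

Lemma fee_minE psi x k :
  (fee_min psi x)%:E = minI (fun i => c x (y i) + psi ord0 i).
Proof.
rewrite /fee_min.
by have [i -> _] := minIE (fun i => c x (y i) + psi ord0 i) k.
Qed.

Lemma fee_min_le psi x i : fee_min psi x <= c x (y i) + psi ord0 i.
Proof.
rewrite /fee_min.
by have [l -> +] := minIE (fun i => c x (y i) + psi ord0 i) i => /(_ i).
Qed.

Lemma fee_min_Lag psi x i : Lag X y c psi i x ->
  fee_min psi x = c x (y i) + psi ord0 i.
Proof. by move=> [_ E]; rewrite /fee_min -E. Qed.

(* The indicator of the k-th cell is the k-th component of a supergradient of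
   the concave function [fun psi => fee_min psi x]. *)
Lemma fee_min_supergradient psi x k (h : R) : X x ->
  fee_min (h *: delta_mx ord0 k + psi) x
    <= fee_min psi x + h * \1_(Lag X y c psi k) x.
Proof.
move=> Xx; rewrite indicE; have [/set_mem kx|/negP kx] := boolP (x \in _).
  rewrite (fee_min_Lag kx); apply: le_trans (fee_min_le _ _ k) _.
  by rewrite !mxE !eqxx /= !mulr1; lra.
have [i ix] := Lag_cover psi k Xx.
have ik : i != k by apply/eqP => E; apply: kx; rewrite -E; exact/mem_set.
rewrite (fee_min_Lag ix) mulr0 addr0; apply: le_trans (fee_min_le _ _ i) _.
by rewrite !mxE !eqxx /= (negbTE ik) mulr0 add0r.
Qed.

(** * Masses of the cells and integration of the minimum *)

Context (mu : probability (borel_rV R n) R).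
Context (hX : compact X).
Context (hc : forall i x, X x -> {for x, continuous (fun x => c x (y i))}).
Context (muX : mu X = 1%E).
Context (overlap : forall i j (t : R), i != j ->
  mu [set x | X x /\ c x (y i) - c x (y j) = t] = 0%E).

Let cX : closed X. Proof. exact: compact_closed. Qed.

Let mX : measurable (X : set (borel_rV R n)).
Proof. exact: closed_measurable_rV. Qed.

Let muXoo : (mu X < +oo)%E. Proof. by rewrite muX ltry. Qed.

Lemma measurable_cost i :
  measurable_fun (X : set (borel_rV R n)) (fun x => c x (y i)).
Proof.
apply: (measurability _ (measurable_realfun.RGenCInfty.measurableE R)) => //.
(* Closed half-lines unbounded above generate the Borel sets, and their preimages in [X] are closed,
   again using continuity at points of [X] only. *)
move=> _ [_ [a ->] <-]; apply: closed_measurable_rV => x clx.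
have Xx : X x by apply: cX; apply: closureS clx => z [].
split=> //=; rewrite in_itv /= andbT leNgt; apply/negP => ca.
have /clx : nbhs x [set z | c z (y i) < a].
  have ci := hc (i := i) Xx; apply: (ci [set s | s < a]).
  by apply: open_nbhs_nbhs; split => //; exact: open_lt.
by move=> [z [[_ /=]]]; rewrite in_itv /= andbT leNgt => /negP.
Qed.

Lemma measurable_Lag psi i : measurable (Lag X y c psi i : set (borel_rV R n)).
Proof.
rewrite (_ : Lag _ _ _ _ _ = X `&` \bigcap_j (X `&`
    (fun x => c x (y i) - c x (y j)) @^-1` `]-oo, psi ord0 j - psi ord0 i])).
  apply: measurableI => //; apply: fin_bigcap_measurable => // j _.
  apply: measurable_funB => //; exact: measurable_cost.
apply/seteqP; split => [x /LagP[Xx H]|x [Xx H]].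
  by split=> // j _; split => //=; rewrite in_itv /=; have := H j; lra.
by apply/LagP; split => // j; have [_] := H j I; rewrite /= in_itv /=; lra.
Qed.

Lemma cost_bounded i : exists M : R, forall x, X x -> `|c x (y i)| <= M.
Proof.
have : compact ((fun x => c x (y i)) @` X).
  apply: continuous_compact => //; apply: continuous_in_subspaceT => x.
  by move=> /set_mem; exact: hc.
move=> /compact_bounded [M [_ H]]; exists (M + 1) => x Xx.
by apply: (H (M + 1)); [rewrite ltrDl|exists x].
Qed.

Lemma integrable_fee_min psi k : mu.-integrable X (EFin \o fee_min psi).
Proof.
apply: measurable_bounded_integrable => //.
  apply/measurable_EFinP; rewrite (_ : EFin \o _ = fun x =>
    minI (fun i => c x (y i) + psi ord0 i)); last first.
    by apply/funext => x; exact: (fee_minE psi x k).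
  rewrite /minI; elim: (index_enum _) => [|i s IH].
    by under eq_fun do rewrite big_nil; exact: measurable_cst.
  under eq_fun do rewrite big_cons.
  apply: measurable_mine => //; apply/measurable_EFinP.
  by apply: measurable_funD => //; exact: measurable_cost.
have /choice[M HM] := cost_bounded.
(* The sum over all indices dominates the term of whichever index attains the minimum at [x]. *)
exists (\sum_i (M i + `|psi ord0 i|)); split; first exact: num_real.
move=> B /ltW MB x Xx; apply: le_trans MB => /=.
have [i ix] := Lag_cover psi k Xx; rewrite (fee_min_Lag ix).
have M0 j : 0 <= M j + `|psi ord0 j|.
  by rewrite addr_ge0 // (le_trans _ (HM j _ Xx)).
rewrite (bigD1 i) //= ler_wpDr //; first exact: sumr_ge0.
by apply: le_trans (ler_normD _ _) _; rewrite lerD2r; exact: HM.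
Qed.

(** The transport term of [Phi], identified with it in [potentialE]. *)
Definition potential psi : R := \int[mu]_(x in X) fee_min psi x.

Lemma G_Rintegral psi k :
  \int[mu]_(x in X) \1_(Lag X y c psi k) x = G X y c mu psi ord0 k.
Proof.
rewrite /Rintegral integral_indic //; last exact: measurable_Lag.
rewrite mxE; congr (fine (mu _)).
by apply/seteqP; split => [x []//|x Lx]; split => //; case: Lx.
Qed.

Lemma potential_supergradient psi k (h : R) :
  potential (h *: delta_mx ord0 k + psi) - potential psi
    <= h * G X y c mu psi ord0 k.
Proof.
have mL := measurable_Lag psi k.
have iL : mu.-integrable X (EFin \o (\1_(Lag X y c psi k) : borel_rV R n -> R)).
  apply: measurable_bounded_integrable => //.
  exists 1; split => // B /ltW B1 x _ /=; apply: le_trans B1; rewrite indicE.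
  by case: (_ \in _); rewrite ?normr1 ?normr0.
have ihL : mu.-integrable X
    (EFin \o (fun x : borel_rV R n => h * \1_(Lag X y c psi k) x)).
  by apply: eq_integrable (integrableZl mX h iL) => // x _; rewrite /= EFinM.
have im := integrable_fee_min psi k.
rewrite lerBlDl -G_Rintegral -RintegralZl // -RintegralD //.
apply: le_Rintegral => //.
- exact: integrable_fee_min.
- by apply: eq_integrable (integrableD mX im ihL) => // x _; rewrite /= EFinD.
- move=> x; exact: fee_min_supergradient.
Qed.

Lemma GE psi k : mu (Lag X y c psi k) = (G X y c mu psi ord0 k)%:E.
Proof. by rewrite mxE fineK // fin_num_measure //; exact: measurable_Lag. Qed.

Lemma le_G psi psi' k : Lag X y c psi k `<=` Lag X y c psi' k ->
  G X y c mu psi ord0 k <= G X y c mu psi' ord0 k.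
Proof.
move=> sub; rewrite -lee_fin -!GE; apply: le_measure => //; rewrite inE;
exact: measurable_Lag.
Qed.

(** At a point of both cells the two costs differ by exactly [psi^j - psi^i], so [overlap]
    applies. *)
Lemma Lag_overlap psi i j : i != j ->
  mu.-negligible (Lag X y c psi i `&` Lag X y c psi j).
Proof.
move=> ij; pose t := psi ord0 j - psi ord0 i.
pose Z := [set x | X x /\ c x (y i) - c x (y j) = t] : set (borel_rV R n).
have mZ : measurable Z.
  apply: closed_measurable_rV.
  apply: (coincidence_closed (f := fun x => c x (y i))
    (g := fun x => c x (y j))) => // x Xx.
  by split; exact: hc.
apply: (@negligibleS _ (borel_rV R n) _ mu Z); last first.
  by apply/negligibleP => //; exact: overlap.
move=> x [/LagP[Xx Hi] /LagP[_ Hj]]; split => //.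
by have := Hi j; have := Hj i; rewrite /t; lra.
Qed.

Lemma measure_Lag_bigcup psi (s : seq 'I_N) : uniq s ->
  mu (\bigcup_(i in [set` s]) Lag X y c psi i)
  = (\sum_(i <- s) mu (Lag X y c psi i))%E.
Proof.
elim: s => [_|i s IH /= /andP[si us]].
  by rewrite bigcup_seq !big_nil measure0.
have mL j := measurable_Lag psi j.
rewrite big_cons -(IH us) bigcup_seq big_cons -bigcup_seq.
set A := Lag _ _ _ _ _; set B := \bigcup_(_ in _) _.
have mB : measurable (B : set (borel_rV R n)).
  by apply: fin_bigcup_measurable => // j _.
have AB0 : mu (A `&` B) = 0%E.
  apply/negligibleP; first by apply: measurableI => //; exact: mL.
  rewrite setI_bigcupr; apply: negligible_countable_bigcup => j js.
  by apply: Lag_overlap; apply: contraNneq si => ->; exact: js.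
(* Making the union disjoint removes only the null set [A] intersected with [B] from the head
   cell. *)
have -> : A `|` B = (A `\` B) `|` B by rewrite setUDl setDv setD0.
rewrite measureU //; last first.
- by apply/seteqP; split => [x [[_ ?] ?]|].
- by apply: measurableD => //; exact: mL.
have : mu A = (mu (A `\` B) + mu (A `&` B))%E.
  exact: (measureDI mu (mL i) mB).
by rewrite AB0 adde0 => ->.
Qed.

(** The cells cover [X], which has full mass, and overlap in null sets. *)
Lemma sum_G psi k : \sum_i G X y c mu psi ord0 i = 1.
Proof.
apply: EFin_inj; rewrite -sumEFin -muX.
under eq_bigr do rewrite -GE.
rewrite -(measure_Lag_bigcup psi (index_enum_uniq _)); congr (mu _).
apply/seteqP; split => [x [i _ []]//|x Xx].
by have [i ix] := Lag_cover psi k Xx; exists i => //=; exact: mem_index_enum.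
Qed.

(** * Continuity of the masses along axes and the derivative of the transport term *)

Lemma natSinv_small (e : R) : 0 < e -> exists m, m.+1%:R^-1 < e.
Proof.
move=> e0; have [m _ H] := near_infty_natSinv_lt (PosNum e0).
by exists m; exact: (H m (leqnn m)).
Qed.

(** The cells shrink as the shift increases to 0 and their intersection is exactly the limit cell,
    so continuity of a finite measure from above suffices. *)
Lemma G_line_left psi k :
  G X y c mu (- m.+1%:R^-1 *: delta_mx ord0 k + psi) ord0 k @[m --> \oo]
  --> G X y c mu psi ord0 k.
Proof.
pose A m := Lag X y c (- m.+1%:R^-1 *: delta_mx ord0 k + psi) k.
have capA : \bigcap_m A m = Lag X y c psi k.
  apply/seteqP; split => [x Ax|x Lx m _]; last first.
    by apply: Lag_line_le0 Lx; rewrite oppr_le0.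
  have Xx : X x by have [] := Ax 0%N I.
  (* Membership in the [m]-th cell gives the desired inequality up to an error [1/(m+1)], which is
     made smaller than [e]. *)
  apply/LagP; split => // j; apply/ler_addgt0Pr => e e0.
  have [m me] := natSinv_small e0.
  have /LagP[_ /(_ j)] := Ax m I; rewrite !mxE !eqxx /= mulr1.
  have [->|jk] := eqVneq j k; first by move=> _; rewrite lerDl ltW.
  by rewrite mulr0 add0r; move: (m.+1%:R^-1) me => u me H; lra.
suff : mu \o A @ \oo --> (G X y c mu psi ord0 k)%:E.
  move=> /fine_cvgP[_]; apply: cvg_trans; apply: near_eq_cvg.
  by near=> m; rewrite /= /A GE.
rewrite -GE -capA.
have Aoo : (mu (A 0%N) < +oo)%E by rewrite /A GE ltry.
apply: nonincreasing_cvg_mu.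
- exact: Aoo.
- by move=> m; exact: measurable_Lag.
- by rewrite capA; exact: measurable_Lag.
- move=> a b ab; apply/subsetPset; apply: Lag_line_antimono.
  by rewrite lerN2 lef_pV2 ?posrE// ler_nat ltnS.
Unshelve. all: by end_near. Qed.

(** Here the cells grow, but their union may miss the points where [k] ties with another index.
    These lie in overlaps of cells, hence in a null set. *)
Lemma G_line_right psi k :
  G X y c mu (m.+1%:R^-1 *: delta_mx ord0 k + psi) ord0 k @[m --> \oo]
  --> G X y c mu psi ord0 k.
Proof.
pose A m := Lag X y c (m.+1%:R^-1 *: delta_mx ord0 k + psi) k.
have mA : measurable (\bigcup_m A m : set (borel_rV R n)).
  by apply: bigcup_measurable => m _; exact: measurable_Lag.
have AL : \bigcup_m A m `<=` Lag X y c psi k.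
  by move=> x [m _]; exact: Lag_line_ge0.
have LA : Lag X y c psi k `\` (\bigcup_m A m) `<=`
    \bigcup_(j in [set j | j != k]) (Lag X y c psi k `&` Lag X y c psi j).
  move=> x [Lx nA]; apply: contrapT => no.
  have [Xx H] := (LagP psi k x).1 Lx.
  have gap j : j != k -> 0 < c x (y j) + psi ord0 j - (c x (y k) + psi ord0 k).
    move=> jk; rewrite subr_gt0 ltNge; apply/negP => jk_le; apply: no.
    exists j => //; split => //; apply/LagP; split => // l.
    exact: le_trans jk_le (H l).
  (* At a point without ties, [d] is the smallest margin by which [k] beats a competitor, capped at
     1; a shift below [d] keeps the point in the cell. *)
  pose d := \big[Num.min/1]_(j | j != k)
    (c x (y j) + psi ord0 j - (c x (y k) + psi ord0 k)).
  have d0 : 0 < d by apply/bigmin_gtP; split => // j; exact: gap.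
  have [m md] := natSinv_small d0.
  apply: nA; exists m => //; apply/LagP; split => // j.
  rewrite !mxE !eqxx /= mulr1.
  have [->|jk] := eqVneq j k; first by rewrite mulr1.
  have : d <= c x (y j) + psi ord0 j - (c x (y k) + psi ord0 k).
    exact: bigmin_le_cond.
  by rewrite mulr0 add0r; move: (m.+1%:R^-1) md => u md; lra.
have E : mu (\bigcup_m A m) = mu (Lag X y c psi k).
  have : mu (Lag X y c psi k) = (mu (Lag X y c psi k `\` \bigcup_m A m)
      + mu (Lag X y c psi k `&` \bigcup_m A m))%E.
    exact: (measureDI mu (measurable_Lag psi k) mA).
  rewrite (setIidr AL) => ->.
  suff -> : mu (Lag X y c psi k `\` \bigcup_m A m) = 0%E by rewrite add0e.
  apply/negligibleP; first by apply: measurableD => //; exact: measurable_Lag.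
  apply: (@negligibleS _ (borel_rV R n) _ mu _ _ LA).
  apply: negligible_countable_bigcup => j /= jk; apply: Lag_overlap.
  by rewrite eq_sym.
suff : mu \o A @ \oo --> (G X y c mu psi ord0 k)%:E.
  move=> /fine_cvgP[_]; apply: cvg_trans; apply: near_eq_cvg.
  by near=> m; rewrite /= /A GE.
rewrite -GE -E.
apply: nondecreasing_cvg_mu => //; first by move=> m; exact: measurable_Lag.
move=> a b ab; apply/subsetPset; apply: Lag_line_antimono.
by rewrite lef_pV2 ?posrE// ler_nat ltnS.
Unshelve. all: by end_near. Qed.

(** By monotonicity in the shift, the two sequential limits trap the values at all small [h]. *)
Lemma G_line_cvg psi k :
  G X y c mu (h *: delta_mx ord0 k + psi) ord0 k @[h --> (0 : R)]
  --> G X y c mu psi ord0 k.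
Proof.
apply/cvgrPdist_le => e e0.
have /cvgrPdist_le /(_ _ e0) [a _ Ha] := @G_line_left psi k.
have /cvgrPdist_le /(_ _ e0) [b _ Hb] := @G_line_right psi k.
near=> h.
have ha : - a.+1%:R^-1 <= h.
  suff : `|h| <= a.+1%:R^-1 by rewrite ler_norml => /andP[].
  by near: h; apply: (@nbhs0_le R R^o).
have hb : h <= b.+1%:R^-1.
  suff : `|h| <= b.+1%:R^-1 by rewrite ler_norml => /andP[].
  by near: h; apply: (@nbhs0_le R R^o).
have := Ha a (leqnn a); have := Hb b (leqnn b); rewrite /=.
have := le_G (@Lag_line_antimono psi k _ _ ha).
have := le_G (@Lag_line_antimono psi k _ _ hb).
by rewrite !ler_norml => ? ? /andP[? ?] /andP[? ?]; apply/andP; split; lra.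
Unshelve. all: by end_near. Qed.

Lemma potential_derive psi k :
  is_derive psi (delta_mx ord0 k) potential (G X y c mu psi ord0 k).
Proof.
have cv : h^-1 *:
    ((potential \o shift psi) (h *: delta_mx ord0 k) - potential psi)
    @[h --> (0 : R)^'] --> (G X y c mu psi ord0 k : R^o).
  apply/cvgrPdist_le => e e0.
  have /cvgrPdist_le /(_ _ e0) H := @G_line_cvg psi k.
  near=> h.
  have h0 : h != 0 by near: h; exact: nbhs_dnbhs_neq.
  have : `|G X y c mu psi ord0 k
      - G X y c mu (h *: delta_mx ord0 k + psi) ord0 k| <= e.
    by near: h; apply: cvg_within; exact: H.
  (* The inequality at [psi] with increment [h], and at the shifted point with increment [- h],
     bound the same difference of potentials by [h] times a value of [G^k] on either side. Dividing
     by [h] swaps the bounds when [h < 0]. *)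
  have := potential_supergradient psi k h.
  have := potential_supergradient (h *: delta_mx ord0 k + psi) k (- h).
  rewrite addrA -scalerDl addNr scale0r add0r /= /shift /=.
  set p := potential psi; set q := potential _; set s := G _ _ _ _ psi _ _.
  set t := G _ _ _ _ _ _ _ => H1 H2.
  have -> : h^-1 *: (q - p) = (q - p) / h by rewrite /GRing.scale /= mulrC.
  rewrite !ler_norml => /andP[H3 H4].
  have [hgt|hlt] : 0 < h \/ h < 0 by apply/orP; rewrite orbC -neq_lt.
    have Q1 : (q - p) / h <= s by rewrite ler_pdivrMr // mulrC.
    have Q2 : t <= (q - p) / h by rewrite ler_pdivlMr // mulrC; lra.
    by apply/andP; split; lra.
  have Q1 : s <= (q - p) / h by rewrite ler_ndivlMr // mulrC.
  have Q2 : (q - p) / h <= t by rewrite ler_ndivrMr // mulrC; lra.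
  by apply/andP; split; lra.
by split; [apply/cvg_ex; exists (G X y c mu psi ord0 k)|exact/cvg_lim].
Unshelve. all: by end_near. Qed.

Lemma potentialE psi (k : 'I_N) :
  potential psi
  = fine (\int[mu]_(x in X) minI (fun i => c x (y i) + psi ord0 i)%R)%E.
Proof.
rewrite /potential /Rintegral; congr fine.
by apply: eq_integral => x _; rewrite (fee_minE psi x k).
Qed.

(** [grad] consists of directional derivatives, so [potential_derive] covers the transport term. *)
Lemma grad_Phi (F : 'rV[R]_N -> \bar R) psi k :
  differentiable (Fstar F) psi ->
  grad (Phi X y c mu F) psi ord0 k
  = G X y c mu psi ord0 k - partial (Fstar F) k psi.
Proof.
move=> dF; rewrite mxE /partial.
rewrite (_ : Phi X y c mu F = potential \- Fstar F); last first.
  by apply/funext => p; rewrite /Phi -(potentialE p k).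
have [dH <-] := potential_derive psi k.
by rewrite deriveB //; exact: diff_derivable.
Qed.

End cells.

(** * The l1 estimate for one step, and its iteration over the routine *)

Lemma l1_dist_transfer (R : realDomainType) (I : finType) (k : I)
    (a a' b b' : I -> R) :
  a k <= b k -> a' k <= b' k -> (forall j, j != k -> a' j <= a j) ->
  \sum_i a i = \sum_i a' i ->
  \sum_(j | j != k) `|b j - b' j| <= b k - b' k ->
  \sum_i `|a' i - b' i| <= \sum_i `|a i - b i|.
Proof.
move=> ab ab' aa' sumE sumb.
rewrite (bigD1 k) //= [leRHS](bigD1 k) //=.
move: sumE; rewrite (bigD1 k) //= [RHS](bigD1 k) //= => sumE.
(* The growth of component [j] is charged to the mass [a j - a' j] it gives up and to the change of
   [b j]. Equal totals turn the first charge into [a' k - a k]. *)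
have : \sum_(j | j != k) `|a' j - b' j| <=
    \sum_(j | j != k) (`|a j - b j| + (a j - a' j) + `|b j - b' j|).
  apply: ler_sum => j /aa' ajk.
  rewrite -[X in _ + X + _]ger0_norm ?subr_ge0// (distrC (a j) (a' j)).
  have -> : a' j - b' j = (a j - b j) + (a' j - a j) + (b j - b' j) by ring.
  by apply: le_trans (ler_normD _ _) _; rewrite lerD2r ler_normD.
rewrite !big_split /= sumrN.
(* Since [a] stays below [b] at [k], component [k] drops by exactly [(a' k - a k) + (b k - b' k)],
   which pays for both charges. *)
rewrite (ler0_norm (x := a k - b k)) ?subr_le0//.
rewrite (ler0_norm (x := a' k - b' k)) ?subr_le0//.
lra.
Qed.

Section shuffling.
Context {R : realType} {n N : nat}.
Context (X : set 'rV[R]_n) (y : 'I_N -> 'rV[R]_n).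
Context (c : 'rV[R]_n -> 'rV[R]_n -> R) (mu : probability (borel_rV R n) R).
Context (eps : R) (V : 'rV[R]_N -> R).
Context (V_step : forall i psi psi',
  shuffle_step X y c mu eps i psi psi' -> V psi' <= V psi).

Lemma shuffle_for_antimono s psi psi' :
  shuffle_for X y c mu eps s psi psi' -> V psi' <= V psi.
Proof.
by elim=> [//|i {}s p p' p'' /V_step pp' _ /le_trans]; apply.
Qed.

(** Any run that returns is a finite chain of steps, so induction on the run carries the one-step
    bound for [V] to the output. *)
Lemma shuffle_antimono psi psi' :
  shuffle X y c mu eps psi psi' -> V psi' <= V psi.
Proof.
by elim=> [//|p p' p'' _ /shuffle_for_antimono pp' _ /le_trans]; apply.
Qed.

End shuffling.

Theorem proposition3p2 (R : realType) (n N : nat)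
  (hn : (2 <= n)%N) (hN : (1 <= N)%N)
  (X : set 'rV[R]_n) (hX : compact X)
  (y : 'I_N -> 'rV[R]_n) (hy : injective y)
  (c : 'rV[R]_n -> 'rV[R]_n -> R)
  (mu : probability (borel_rV R n) R) (hmuX : mu (~` X) = 0%E)
  (rho : 'rV[R]_n -> R)
  (hrho_meas : measurable_fun [set: borel_rV R n] rho)
  (hrho_ge0 : forall x, 0 <= rho x)
  (hmu_rho : forall A : set (borel_rV R n), measurable A ->
     mu A = (\int[lebesgue_rV n]_(x in A) (rho x)%:E)%E)
  (alpha : R) (halpha : 0 < alpha <= 1) (hrho : holder_on alpha X rho)
  (hReg : Reg X y c) (hTwist : Twist X y c)
  (Yexp : 'I_N -> set 'rV[R]_n) (expc : 'I_N -> 'rV[R]_n -> 'rV[R]_n)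
  (hQC : QC X y c Yexp expc) (hXconvex : c_convex X Yexp expc)
  (F : 'rV[R]_N -> \bar R) (hF : storage_fee F)
  (eps : R) (heps : 0 < eps < (3 * N%:R)^-1)
  (psi_in psi_out : 'rV[R]_N)
  (hshuffle : shuffle X y c mu eps psi_in psi_out)
  (hFdiff : forall psi, differentiable (Fstar F) psi)
  (hFge : forall psi k, 3 * eps <= grad (Fstar F) psi ord0 k)
  (hFdom : forall (k : 'I_N) (psi1 psi2 : 'rV[R]_N) (gamma : R),
     0 <= gamma -> psi2 = psi1 - gamma *: delta_mx ord0 k ->
     \sum_(j | j != k) `|partial (Fstar F) j psi1 - partial (Fstar F) j psi2|
       <= partial (Fstar F) k psi1 - partial (Fstar F) k psi2) :
  norm1 (grad (Phi X y c mu F) psi_out) <= norm1 (grad (Phi X y c mu F) psi_in).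
Proof.
have cX : closed X by exact: compact_closed.
have mX : measurable (X : set (borel_rV R n)) by exact: closed_measurable_rV.
have muX : mu X = 1%E.
  have := probability_setC mu mX.
  rewrite hmuX => /esym/eqP.
  by rewrite sube_eq // ?fin_num_measure // add0e => /eqP <-.
have hc i x : X x -> {for x, continuous (fun x => c x (y i))}.
  have [U [oU XU CU]] := hReg i; move=> /XU /CU [+ _].
  exact: differentiable_continuous.
have overlap i j (t : R) : i != j ->
    mu [set x | X x /\ c x (y i) - c x (y j) = t] = 0%E.
  move=> ij; have [U [oU XU CU]] := hReg i; have [W [oW XW CW]] := hReg j.
  have mZ : measurable ([set x | X x /\ c x (y i) - c x (y j) = t]
      : set (borel_rV R n)).
    apply: closed_measurable_rV; apply: (coincidence_closed
      (f := fun x => c x (y i)) (g := fun x => c x (y j))) => // x Xx.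
    by split; exact: hc.
  (* (Twist) makes the coincidence set Lebesgue-null, and integrating the density over it gives
     [mu]-measure 0. *)
  rewrite hmu_rho //; apply: null_set_integral => //.
    by apply/measurable_EFinP; apply: measurable_funS hrho_meas.
  (* The two costs are C^2 on different neighbourhoods of [X]; their intersection serves both. *)
  apply: (@coincidence_null _ _ _ _ _ (U `&` W)) => //.
  - exact: openI.
  - by move=> x Xx; split; [exact: XU|exact: XW].
  - by move=> x [/CU].
  - by move=> x [_ /CW].
  - by move=> x Xx; exact: hTwist.
have gradPhi := grad_Phi hX hc muX overlap.
have normE psi : norm1 (grad (Phi X y c mu F) psi)
    = \sum_i `|G X y c mu psi ord0 i - partial (Fstar F) i psi|.
  by apply: eq_bigr => i _; rewrite gradPhi.
rewrite !normE.
apply: (shuffle_antimono (V := fun psi =>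
  \sum_i `|G X y c mu psi ord0 i - partial (Fstar F) i psi|)) hshuffle.
move=> i psi psi'; rewrite /shuffle_step; case: ifP => [Gi|_ ->//].
move=> [r [r0 -> /andP[_ Gi']]].
have eps0 : 0 < eps by case/andP: heps.
have Fge p k : 3 * eps <= partial (Fstar F) k p.
  by have := hFge p k; rewrite mxE.
apply: (l1_dist_transfer (k := i)).
(* Before the step the guard gives [G^i <= eps]; after it the search gives [G^i <= 3 * eps]. Both
   lie below the partial derivative of [Fstar F]. *)
- by apply: le_trans Gi _; apply: le_trans (Fge _ _); lra.
- exact: le_trans Gi' (Fge _ _).
- by move=> j ji; apply: le_G => //; apply: Lag_lower => //; exact: ltW.
- by rewrite !sum_G.
- by apply: (hFdom i psi _ r) => //; exact: ltW.
Qed.
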